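(* Let $P$ be a bit-vector program with $k$ variables, each $b$ bits wide, so that its state space is $\mathcal{S} = (\{0,1\}^b)^k$, and let $T \subseteq \mathcal{S}\times\mathcal{S}$ be its transition relation. If $P$ is terminating (there is no infinite sequence $x_1, x_2, \ldots \in \mathcal{S}$ with $T(x_i,x_{i+1})$ for all $i$), then $P$ has a ranking function $R$ that is computed by a finite $\mathcal{L}$-program.
   Context: A ranking function for $T$ is a function $R : \mathcal{S} \to Y$, where $Y$ is a well-founded set with order $>$, such that $R$ is injective and $\forall x,x' \in \mathcal{S}.\ T(x,x') \Rightarrow R(x) > R(x')$. For functions computed by $\mathcal{L}$-programs, values are tuples of $b$-bit words ordered lexicographically ($y > y'$ iff there is $i$ with $z_i > z'_i$ and $z_j = z'_j$ for all $j<i$), each coordinate compared as an unsigned integer. An $\mathcal{L}$-program is a finite list of instructions operating on $b$-bit words; each instruction consists of an opcode and one or more operands, each operand being a constant, one of the program's inputs, or the result of a previous instruction. The opcodes are: add, sub, mul, div, neg, mod, min, max; bitwise and, or, xor, logical and arithmetic shift right, not; unsigned comparisons le, lt, signed comparisons sle, slt, eq, neq; implies, ite (if-then-else); floating-point fadd, fsub, fmul, fdiv. *)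

(* Defs.v *)
From mathcomp Require Import all_boot all_order all_algebra.

Set Implicit Arguments.
Unset Strict Implicit.
Unset Printing Implicit Defensive.

(* Little endian: bit [i] of a word has weight [2 ^ i]. *)
Notation word b := (b.-tuple bool).
Notation state b k := (k.-tuple (word b)).

Section Words.
Variable b : nat.
Implicit Types u v w : word b.

Definition to_nat w : nat := \sum_(i < b) tnth w i * 2 ^ i.
Definition of_nat (n : nat) : word b := [tuple odd (n %/ 2 ^ i) | i < b].
Definition of_bool (c : bool) : word b := of_nat c.

Definition msb w : bool := last false w.

(* Two's complement value. *)
Definition to_int w : int := (Posz (to_nat w) - Posz (msb w * 2 ^ b)%N)%R.

Definition truth w : bool := to_nat w != 0.

Definition shift_right (fill : bool) w (s : nat) : word b :=
  [tuple nth fill w (i + s) | i < b].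

Definition bitwise (f : bool -> bool -> bool) u v : word b :=
  [tuple f (tnth u i) (tnth v i) | i < b].

End Words.

Inductive fp_opcode := Fadd | Fsub | Fmul | Fdiv.

Inductive unary_opcode := Neg | Not.

Inductive binary_opcode :=
  | Add | Sub | Mul | Div | Mod | Min | Max
  | And | Or | Xor | Lshr | Ashr
  | Le | Lt | Sle | Slt | Eq | Neq
  | Implies
  | Fp of fp_opcode.

Section Opcodes.
Variable b : nat.

(* No floating-point format is attached to an arbitrary width [b], so the
   meaning of the four floating-point opcodes is a parameter. *)
Variable fp : fp_opcode -> word b -> word b -> word b.

Definition eval_unary (o : unary_opcode) (u : word b) : word b :=
  match o with
  | Neg => of_nat b (2 ^ b - to_nat u)
  | Not => [tuple ~~ tnth u i | i < b]
  end.

(* [div] and [mod] are unsigned; as in SMT-LIB, dividing by zero yields the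
   all-ones word and the remainder modulo zero is the dividend, which is what
   [_ %% 0] gives. *)
Definition eval_binary (o : binary_opcode) (u v : word b) : word b :=
  let x := to_nat u in
  let y := to_nat v in
  match o with
  | Add => of_nat b (x + y)
  | Sub => of_nat b (x + (2 ^ b - y))
  | Mul => of_nat b (x * y)
  | Div => if y == 0 then [tuple true | i < b] else of_nat b (x %/ y)
  | Mod => of_nat b (x %% y)
  | Min => if x <= y then u else v
  | Max => if x <= y then v else u
  | And => bitwise andb u v
  | Or => bitwise orb u v
  | Xor => bitwise addb u v
  | Lshr => shift_right false u y
  | Ashr => shift_right (msb u) u y
  | Le => of_bool b (x <= y)
  | Lt => of_bool b (x < y)
  | Sle => of_bool b (to_int u <= to_int v)%R
  | Slt => of_bool b (to_int u < to_int v)%R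
  | Eq => of_bool b (u == v)
  | Neq => of_bool b (u != v)
  | Implies => of_bool b (truth u ==> truth v)
  | Fp f => fp f u v
  end.

Definition eval_ite (c u v : word b) : word b := if truth c then u else v.

End Opcodes.

(* [Result j] is the result of instruction number [j], counted from 0. *)
Inductive operand (b k : nat) :=
  | Const of word b
  | Input of 'I_k
  | Result of nat.

Inductive instruction (b k : nat) :=
  | Unary of unary_opcode & operand b k
  | Binary of binary_opcode & operand b k & operand b k
  | Ite of operand b k & operand b k & operand b k.

Definition L_program (b k : nat) := seq (instruction b k).

Section Programs.
Variables b k : nat.

Definition operand_ok (n : nat) (o : operand b k) : bool :=
  if o is Result j then j < n else true.

Definition instruction_ok (n : nat) (c : instruction b k) : bool :=
  match c with
  | Unary _ o1 => operand_ok n o1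
  | Binary _ o1 o2 => operand_ok n o1 && operand_ok n o2
  | Ite o1 o2 o3 => [&& operand_ok n o1, operand_ok n o2 & operand_ok n o3]
  end.

Fixpoint well_formed_from (n : nat) (p : L_program b k) : bool :=
  if p is c :: p' then instruction_ok n c && well_formed_from n.+1 p'
  else true.

(* Operands only refer to results of previous instructions. *)
Definition well_formed (p : L_program b k) : bool := well_formed_from 0 p.

Variable fp : fp_opcode -> word b -> word b -> word b.

(* The default value of [nth] is never used by a well-formed program. *)
Definition eval_operand (x : state b k) (rs : seq (word b)) (o : operand b k) :
    word b :=
  match o with
  | Const w => w
  | Input i => tnth x i
  | Result j => nth (of_nat b 0) rs j
  end.

Definition eval_instruction (x : state b k) (rs : seq (word b))
    (c : instruction b k) : word b :=
  let ev := eval_operand x rs in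
  match c with
  | Unary o o1 => eval_unary o (ev o1)
  | Binary o o1 o2 => eval_binary fp o (ev o1) (ev o2)
  | Ite o1 o2 o3 => eval_ite (ev o1) (ev o2) (ev o3)
  end.

(* The results of all the instructions, in program order. *)
Definition run (p : L_program b k) (x : state b k) : seq (word b) :=
  foldl (fun rs c => rcons rs (eval_instruction x rs c)) [::] p.

(* A program with [m] outputs returns the results of its last [m]
   instructions. *)
Definition computes (m : nat) (p : L_program b k)
    (f : state b k -> m.-tuple (word b)) : Prop :=
  [/\ well_formed p, m <= size p
    & forall x, tval (f x) = drop (size p - m) (run p x)].

End Programs.

Definition lex_gt (b m : nat) (y y' : m.-tuple (word b)) : Prop :=
  exists i : 'I_m,
    to_nat (tnth y i) > to_nat (tnth y' i) /\
    forall j : 'I_m, j < i -> tnth y j = tnth y' j.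

Definition well_founded_order (Y : Type) (gt : Y -> Y -> Prop) : Prop :=
  (forall y1 y2 y3, gt y1 y2 -> gt y2 y3 -> gt y1 y3) /\
  well_founded (fun y y' => gt y' y).

Definition ranking_function (S Y : Type) (gt : Y -> Y -> Prop) (T : rel S)
    (R : S -> Y) : Prop :=
  [/\ well_founded_order gt, injective R
    & forall x x', T x x' -> gt (R x) (R x')].

Definition terminating (S : Type) (T : rel S) : Prop :=
  ~ exists x : nat -> S, forall i, T (x i) (x i.+1).

(* Main.v *)
(** Reachability in a terminating finite transition system is antisymmetric, so
    listing the states by decreasing number of reachable states is a topological
    sort [s_0, s_1, ...] of [T].  The one-hot tuple whose [i]-th word is [x == s_i]
    is then an injective ranking function for the lexicographic order.  It is
    computed by an [L_program] because every function on states is: nested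
    [Ite]s compare the inputs with each of the finitely many states. *)

Require Import Defs.
From mathcomp Require Import all_boot all_order all_algebra.

Set Implicit Arguments.
Unset Strict Implicit.
Unset Printing Implicit Defensive.

(** * Every function on states is computed by a program *)

Lemma to_nat_of_bool (b : nat) (c : bool) :
  0 < b -> to_nat (of_bool b c) = c.
Proof.
case: b => [//|b] _; rewrite /to_nat big_ord_recl big1 ?addn0 => [|i _].
  by rewrite tnth_mktuple expn0 divn1 muln1; case: c.
rewrite tnth_mktuple divn_small //.
by apply: leq_ltn_trans (leq_b1 c) _; rewrite lift0 (ltn_exp2l 0).
Qed.

(** Settles the degenerate width 0, where [of_bool] can no longer tell [true] from [false]. *)
Lemma state0_eq (k : nat) (x y : state 0 k) : x = y.
Proof. by apply: eq_from_tnth => i; rewrite [LHS]tuple0 [RHS]tuple0. Qed.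

Section Computability.
Variables b k : nat.
Variable fp : fp_opcode -> word b -> word b -> word b.
Implicit Types (x : state b k) (rs : seq (word b)) (p q : L_program b k).

(** This is [run] started from results already present, so that running a concatenation splits into
    two runs. *)
Definition exec x rs p : seq (word b) :=
  foldl (fun rs c => rcons rs (eval_instruction fp x rs c)) rs p.

Lemma exec_cat x rs p q : exec x rs (p ++ q) = exec x (exec x rs p) q.
Proof. exact: foldl_cat. Qed.

Lemma exec_prefix x rs p :
  exists2 rs', exec x rs p = rs ++ rs' & size rs' = size p.
Proof.
elim: p rs => [|c p IHp] rs /=; first by exists [::]; rewrite ?cats0.
have [rs' -> <-] := IHp (rcons rs (eval_instruction fp x rs c)).
by exists (eval_instruction fp x rs c :: rs'); rewrite ?cat_rcons.
Qed.

Lemma size_exec x rs p : size (exec x rs p) = size rs + size p.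
Proof. by have [rs' -> <-] := exec_prefix x rs p; rewrite size_cat. Qed.

Lemma eval_operand_exec x rs p (o : operand b k) :
  operand_ok (size rs) o ->
  eval_operand x (exec x rs p) o = eval_operand x rs o.
Proof.
have [rs' -> _] := exec_prefix x rs p.
by case: o => //= j ltj; rewrite nth_cat ltj.
Qed.

Lemma well_formed_from_cat n p q :
  well_formed_from n (p ++ q) =
  well_formed_from n p && well_formed_from (n + size p) q.
Proof.
elim: p n => [|c p IHp] n /=; first by rewrite addn0.
by rewrite IHp addSnnS andbA.
Qed.

Lemma operand_okW n n' (o : operand b k) :
  n <= n' -> operand_ok n o -> operand_ok n' o.
Proof. by case: o => //= j len ltj; apply: leq_trans len. Qed.

(* Quantifying over the number [n] of results already available lets programs be
   concatenated without renumbering their operands. *)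
Definition computable (F : state b k -> seq (word b)) : Prop :=
  forall n, exists p os,
    [/\ well_formed_from n p, all (operand_ok (n + size p)) os
      & forall x rs, size rs = n ->
          map (eval_operand x (exec x rs p)) os = F x].

Lemma eq_computable F G : F =1 G -> computable F -> computable G.
Proof.
move=> eqFG cF n; have [p [os [wfp okos evos]]] := cF n.
by exists p, os; split=> // x rs ?; rewrite -eqFG evos.
Qed.

Lemma computable_nil : computable (fun=> [::]).
Proof. by move=> n; exists [::], [::]. Qed.

Lemma computable_const w : computable (fun=> [:: w]).
Proof. by move=> n; exists [::], [:: Const k w]. Qed.

(** The second program is built for the offset reached after the first. Running it only appends
    results, so the operands that the first program delivers keep their values. *)
Lemma computable_cat F G :
  computable F -> computable G -> computable (fun x => F x ++ G x).
Proof.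
move=> cF cG n; have [p [os [wfp okos evos]]] := cF n.
have [q [os' [wfq okos' evos']]] := cG (n + size p).
exists (p ++ q), (os ++ os'); split.
- by rewrite well_formed_from_cat wfp.
- rewrite size_cat addnA all_cat okos' andbT.
  by apply: sub_all okos => o; apply/operand_okW/leq_addr.
move=> x rs sz_rs; rewrite exec_cat map_cat evos' ?size_exec ?sz_rs //.
congr (_ ++ _); rewrite -(evos x rs sz_rs).
elim: os okos {evos} => //= o os IHos /andP[oko /IHos->].
by rewrite eval_operand_exec // size_exec sz_rs.
Qed.

Lemma computable_eq (j : 'I_k) (w : word b) :
  computable (fun x => [:: of_bool b (tnth x j == w)]).
Proof.
move=> n; exists [:: Binary Eq (Input b j) (Const k w)], [:: Result b k n].
split=> //= [|x rs <-]; first by rewrite addn1 ltnSn.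
by rewrite nth_rcons ltnn eqxx.
Qed.

Lemma computable_ite (c g h : state b k -> word b) :
  computable (fun x => [:: c x]) -> computable (fun x => [:: g x]) ->
  computable (fun x => [:: h x]) ->
  computable (fun x => [:: eval_ite (c x) (g x) (h x)]).
Proof.
move=> cc cg ch n.
have [p [os [wfp okos evos]]] := computable_cat cc (computable_cat cg ch) n.
(* Evaluating at an arbitrary state and result list shows that [os] consists of exactly three
   operands. *)
have /(congr1 size) := evos [tuple of_nat b 0 | _ < k] (nseq n (of_nat b 0)) (size_nseq _ _).
case: os okos evos => [|o1 [|o2 [|o3 []]]] //= okos evos _.
exists (rcons p (Ite o1 o2 o3)), [:: Result b k (n + size p)]; split.
- by rewrite -cats1 well_formed_from_cat wfp /= -(andbT (operand_ok _ o3)) okos.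
- by rewrite size_rcons /= addnS ltnSn.
move=> x rs sz_rs; rewrite -cats1 exec_cat /= nth_rcons size_exec sz_rs ltnn eqxx.
by have [-> -> ->] := evos x rs sz_rs.
Qed.

(** Equality of states is tested one coordinate at a time, by nested [Ite]s that all fall back to
    [g]. *)
Lemma computable_if_eq (s : state b k) (w : word b) (g : state b k -> word b) :
  0 < b -> computable (fun x => [:: g x]) ->
  computable (fun x => [:: if x == s then w else g x]).
Proof.
move=> b_gt0 cg.
suff cjs (js : seq 'I_k) : computable (fun x =>
    [:: if all (fun j => tnth x j == tnth s j) js then w else g x]).
  apply: eq_computable (cjs (enum 'I_k)) => x; congr [:: if _ then _ else _].
  apply/allP/eqP => [eq_xs | -> //]; apply: eq_from_tnth => j.
  by apply/eqP/eq_xs; rewrite mem_enum.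
elim: js => [|j js IHjs]; first exact: computable_const.
apply: eq_computable (computable_ite (computable_eq j (tnth s j)) IHjs cg) => x.
by rewrite /eval_ite /truth to_nat_of_bool //= eqb0 negbK -if_and.
Qed.

Lemma computable_word (f : state b k -> word b) :
  computable (fun x => [:: f x]).
Proof.
(* The word [w0] is only a default: the list of states finally used is a full enumeration. *)
have w0 := of_nat b 0; have [b_eq0 | b_gt0] := posnP b.
  apply: eq_computable (computable_const (f [tuple w0 | _ < k])) => x.
  congr [:: f _]; move: x w0; rewrite b_eq0 => x w0; exact: state0_eq.
suff cl (l : seq (state b k)) :
    computable (fun x => [:: if x \in l then f x else w0]).
  by apply: eq_computable (cl (enum {: state b k})) => x; rewrite mem_enum.
elim: l => [|s l IHl]; first exact: computable_const.
apply: eq_computable (computable_if_eq s (f s) b_gt0 IHl) => x.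
by rewrite in_cons; case: eqP => // ->.
Qed.

Lemma computable_seq (fs : seq (state b k -> word b)) :
  computable (fun x => [seq f x | f <- fs]).
Proof.
elim: fs => [|f fs IHfs]; first exact: computable_nil.
exact: computable_cat (computable_word f) IHfs.
Qed.

(* [Ite o o o] is used as a copy instruction. *)
Lemma exec_copy x rs (os : seq (operand b k)) :
  all (operand_ok (size rs)) os ->
  exec x rs [seq Ite o o o | o <- os] = rs ++ map (eval_operand x rs) os.
Proof.
elim/last_ind: os => [|os o IHos]; first by rewrite cats0.
rewrite all_rcons => /andP[oko okos].
rewrite map_rcons -cats1 exec_cat [LHS]/= eval_operand_exec //.
by rewrite /eval_ite if_same IHos // map_rcons rcons_cat.
Qed.

Lemma well_formed_copy n (os : seq (operand b k)) :
  all (operand_ok n) os ->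
  well_formed_from n [seq Ite o o o | o <- os].
Proof.
elim: os n => //= o os IHos n /andP[oko okos]; rewrite oko IHos //.
by apply: sub_all okos => o'; apply: operand_okW.
Qed.

Lemma every_function_computed m (f : state b k -> m.-tuple (word b)) :
  exists p, computes fp p f.
Proof.
have [p [os [wfp okos evos]]] :=
  computable_seq [seq (fun x => tnth (f x) i) | i <- enum 'I_m] 0.
have evf x : map (eval_operand x (exec x [::] p)) os = f x.
  by rewrite evos // -map_comp; apply: map_tnth_enum.
have sz_os : size os = m.
  by rewrite -(size_tuple (f [tuple of_nat b 0 | _ < k])) -evf size_map.
(* The operands [os] may be constants, inputs or scattered results; copying them makes the outputs
   the last [m] results, in order. *)
exists (p ++ [seq Ite o o o | o <- os]); split.
- by rewrite /well_formed well_formed_from_cat wfp well_formed_copy.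
- by rewrite size_cat size_map sz_os leq_addl.
move=> x; rewrite size_cat size_map sz_os addnK -[run _ _ _]/(exec x [::] _).
by rewrite exec_cat exec_copy ?size_exec // drop_size_cat ?size_exec // evf.
Qed.

End Computability.

(** * Well-foundedness of the lexicographic order *)

(** Induction on the number of elements below [y]: by transitivity everything below [z] is below
    [y], while [z] itself is below [y] but not below [z]. *)
Lemma finite_strict_order_wf (Y : finType) (gt : rel Y) :
  transitive gt -> irreflexive gt -> well_founded (fun y y' => gt y' y).
Proof.
move=> gt_trans gt_irr y; have [n] := ubnP #|gt y|.
elim: n y => [|n IHn] y le_n; first by rewrite ltn0 in le_n.
constructor=> z gt_yz; apply: IHn.
apply: leq_trans (proper_card _) le_n; apply/properP; split.
  by apply/subsetP => t; apply: gt_trans.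
by exists z => //; rewrite unfold_in /= gt_irr.
Qed.

Lemma lex_gt_trans (b m : nat) (y1 y2 y3 : m.-tuple (word b)) :
  lex_gt y1 y2 -> lex_gt y2 y3 -> lex_gt y1 y3.
Proof.
move=> [i [gt_i eq_i]] [j [gt_j eq_j]].
have [lt_ij | lt_ji | /val_inj eq_ij] := ltngtP i j.
- exists i; rewrite -eq_j //; split=> // l lt_li.
  by rewrite eq_i // eq_j // (ltn_trans lt_li).
- exists j; rewrite eq_i //; split=> // l lt_lj.
  by rewrite eq_i ?eq_j // (ltn_trans lt_lj).
exists i; split=> [|l lt_li]; last by rewrite eq_i ?eq_j // -eq_ij.
by rewrite -eq_ij in gt_j; apply: ltn_trans gt_i.
Qed.

Lemma lex_gt_well_founded_order (b m : nat) : well_founded_order (@lex_gt b m).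
Proof.
split; first exact: lex_gt_trans.
(* A boolean form of [lex_gt], to which the result on finite types applies. *)
pose gt (y y' : m.-tuple (word b)) :=
  [exists i : 'I_m, (to_nat (tnth y' i) < to_nat (tnth y i)) &&
    [forall j : 'I_m, (j < i) ==> (tnth y j == tnth y' j)]].
have gtP y y' : reflect (lex_gt y y') (gt y y').
  apply: (iffP existsP) => -[i].
    case/andP=> gt_i /forallP eq_i; exists i; split=> // j lt_ji.
    by apply/eqP; apply: implyP lt_ji.
  case=> gt_i eq_i; exists i; rewrite gt_i; apply/forallP => j.
  by apply/implyP => /eq_i->.
have wf_gt : well_founded (fun y y' => gt y' y).
  apply: finite_strict_order_wf => [y2 y1 y3 /gtP gt12 /gtP gt23 | y].
    by apply/gtP; apply: lex_gt_trans gt23.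
  by apply/gtP => -[i []]; rewrite ltnn.
move=> y; elim: (wf_gt y) => {}y _ IHy; constructor=> z /gtP; exact: IHy.
Qed.

(** * Topological sort of a terminating relation *)

Section Termination.
Variables (S : finType) (T : rel S).
Hypothesis T_term : terminating T.

Lemma terminating_acyclic x y : T x y -> ~~ connect T y x.
Proof.
move=> Txy; apply/negP => /connectP[p Tp def_x]; apply: T_term.
have Tc : cycle T (y :: p) by rewrite /= rcons_path Tp -def_x.
(* A path from [y] back to [x], closed by the edge from [x] to [y], is a cycle; going round it
   forever is an infinite run. *)
exists (fun i => iter i (next (y :: p)) y) => i; rewrite iterS.
apply: next_cycle Tc _; elim: i => [|i IHi]; first exact: mem_head.
by rewrite iterS mem_next.
Qed.

(** Whatever [y] reaches, [x] reaches through [y]; but [x] reaches itself and [y] does not reach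
    [x]. *)
Lemma terminating_card_connect x y :
  T x y -> #|connect T y| < #|connect T x|.
Proof.
move=> Txy; apply/proper_card/properP; split.
  by apply/subsetP => z; apply/connect_trans/connect1.
by exists x; [apply: connect0 | apply: terminating_acyclic].
Qed.

Definition topological_sort : seq S :=
  sort (fun x y => #|connect T y| <= #|connect T x|) (enum S).

Lemma mem_topological_sort x : x \in topological_sort.
Proof. by rewrite mem_sort mem_enum. Qed.

Lemma index_topological_sort_inj : injective (index^~ topological_sort).
Proof.
by move=> x y; exact: index_inj (mem_topological_sort x) (mem_topological_sort y).
Qed.

Lemma topological_sort_index x y :
  T x y -> index x topological_sort < index y topological_sort.
Proof.
pose leT x y := #|connect T y| <= #|connect T x|.
have leT_tr : transitive leT by move=> z t u le_zt le_uz; apply: leq_trans le_zt.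
have sorted_s : sorted leT topological_sort.
  by apply: sort_sorted => z t; apply: leq_total.
(* Contrapositive: if [y] were listed no later than [x], sortedness would give [y] at least as many
   reachable states as [x]. *)
move=> /terminating_card_connect; apply: contraTltn; rewrite -leqNgt.
by apply: (sorted_leq_index leT_tr _ sorted_s) => [z||];
  rewrite ?mem_topological_sort // /leT.
Qed.

End Termination.

Theorem theorem6 (b k : nat) (fp : fp_opcode -> word b -> word b -> word b)
    (T : rel (state b k)) (hT : terminating T) :
  exists (m : nat) (R : state b k -> m.-tuple (word b)),
    ranking_function (@lex_gt b m) T R /\
    exists p : L_program b k, computes fp p R.
Proof.
pose s := topological_sort T.
pose R x := [tuple of_bool b (i == index x s :> nat) | i < size s].
exists (size s), R; split; last exact: every_function_computed.
have lt_s x : index x s < size s by rewrite index_mem mem_topological_sort.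
split; first exact: lex_gt_well_founded_order.
- move=> x y eqR; have [b_eq0 | b_gt0] := posnP b.
    by clear -b_eq0; move: x y; rewrite b_eq0 => x y; apply: state0_eq.
  (* The word of [R x] at position [index x s] is 1, so that of [R y] is too, which forces equal
     indices. *)
  have := congr1 (fun t => to_nat (tnth t (Ordinal (lt_s x)))) eqR.
  rewrite !tnth_mktuple !to_nat_of_bool //= eqxx; case: eqP => // eq_xy _.
  exact: (@index_topological_sort_inj _ T).
move=> x y Txy; have lt_xy := topological_sort_index hT Txy.
(* At width 0 there is a single state, so a transition would be a loop, against [lt_xy]. *)
have b_gt0 : 0 < b.
  rewrite lt0n; apply/eqP => b_eq0; suff eq_xy : x = y by rewrite eq_xy ltnn in lt_xy.
  by clear -b_eq0; move: x y; rewrite b_eq0 => x y; apply: state0_eq.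
(* The first difference is at the index of [x]: before it both tuples are zero, and the 1 of [R y]
   comes later. *)
exists (Ordinal (lt_s x)); split=> [|j /= lt_j].
  by rewrite !tnth_mktuple !to_nat_of_bool //= eqxx (ltn_eqF lt_xy).
by rewrite !tnth_mktuple !ltn_eqF // (ltn_trans lt_j).
Qed.
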